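(* Let $G$ be a deductive filter of a square-increasing IRL $\mathbf{A}$. Then $\mathbf{A}/G$ is idempotent if and only if $\neg(f^2)\in G$. In particular, $\mathbf{A}/[\neg(f^2))$ is idempotent, where $[\neg(f^2))=\{x\in A:\neg(f^2)\leqslant x\}$.
   Context: An involutive (commutative) residuated lattice (IRL) is an algebra $\langle A;\cdot,\wedge,\vee,\neg,e\rangle$ such that $\langle A;\cdot,e\rangle$ is a commutative monoid, $\langle A;\wedge,\vee\rangle$ is a lattice with order $\leqslant$, $\neg\neg x=x$, and $x\cdot y\leqslant z\iff \neg z\cdot y\leqslant\neg x$. Write $f:=\neg e$, $x\to y:=\neg(x\cdot\neg y)$, $x^2:=x\cdot x$. It is square-increasing if $x\leqslant x^2$, idempotent if $x^2=x$, for all $x$. A deductive filter of $\mathbf{A}$ is a lattice filter of $\langle A;\wedge,\vee\rangle$ that is also a submonoid of $\langle A;\cdot,e\rangle$ (in the square-increasing case, these are exactly the lattice filters containing $e$, so $[\neg(f^2))$ is one). $\mathbf{A}/G$ is the quotient of $\mathbf{A}$ by the congruence $\{\langle a,b\rangle: a\to b\in G\text{ and } b\to a\in G\}$. *)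

(* Defs.v *)
From HB Require Import structures.
From mathcomp Require Import all_boot all_order.
From mathcomp Require Import boolp classical_sets.

Set Implicit Arguments.
Unset Strict Implicit.
Unset Printing Implicit Defensive.

Import Order.TTheory.

Local Open Scope group_scope.
Local Open Scope order_scope.

(* [\cdot] and [e] are the operations [*] and [1] of the underlying
   [monoidType]; the lattice is that of the underlying [latticeType]. *)
HB.mixin Record isIRL d A of Monoid A & Order.Lattice d A := {
  irl_mulC : commutative (@mul A);
  neg : A -> A;
  negK : involutive neg;
  irl_residuation : forall x y z : A, (x * y <= z) = (neg z * y <= neg x)
}.

#[short(type="irlType")]
HB.structure Definition IRL d :=
  {A of Monoid A & Order.Lattice d A & isIRL d A}.

Definition irl_f {d} {A : irlType d} : A := neg 1.

Definition imp {d} {A : irlType d} (x y : A) : A := neg (x * neg y).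

Definition square_increasing d (A : irlType d) : Prop :=
  forall x : A, x <= x ^+ 2.

Definition idempotent_irl d (A : irlType d) : Prop :=
  forall x : A, x ^+ 2 = x.

Section Filters.
Context {d : Order.disp_t} {A : irlType d}.
Local Open Scope classical_set_scope.

Definition lattice_filter (G : set A) : Prop :=
  [/\ G !=set0,
      forall x y, G x -> G y -> G (x `&` y)%O
    & forall x y, G x -> x <= y -> G y].

Definition submonoid (G : set A) : Prop :=
  G 1 /\ forall x y, G x -> G y -> G (x * y).

Definition deductive_filter (G : set A) : Prop :=
  lattice_filter G /\ submonoid G.

Definition principal_filter (a : A) : set A := [set x | a <= x].

End Filters.

Record dfilter d (A : irlType d) := DFilter {
  dfilter_set :> set A;
  dfilterP : deductive_filter dfilter_set
}.

Section IRLTheory.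
Context {d : Order.disp_t} {A : irlType d}.
Implicit Types x y z t : A.

Lemma le_neg x y : (neg x <= neg y) = (y <= x).
Proof. by rewrite -[y in RHS]mulg1 irl_residuation mulg1. Qed.

Lemma le_imp x y z : (x <= imp y z) = (x * y <= z).
Proof.
by rewrite -le_neg negK irl_mulC irl_residuation !negK.
Qed.

Lemma irl_le_mul x y z t : x <= y -> z <= t -> x * z <= y * t.
Proof.
have aux (a b c : A) : a <= b -> a * c <= b * c.
  by move=> le_ab; rewrite -le_imp; apply: (le_trans le_ab); rewrite le_imp.
move=> le_xy le_zt; apply: (le_trans (aux _ _ z le_xy)).
by rewrite ![y * _]irl_mulC aux.
Qed.

Lemma imp_mp x y : imp x y * x <= y.
Proof. by rewrite -le_imp. Qed.

Lemma imp_negC x y : imp (neg y) (neg x) = imp x y.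
Proof. by rewrite /imp negK irl_mulC. Qed.

Lemma imp_residual x y z : imp (x * y) z = imp (neg z * y) (neg x).
Proof.
by rewrite /imp negK irl_mulC (irl_mulC x) mulgA.
Qed.

Lemma neg_f2_le1 : square_increasing A -> neg (irl_f ^+ 2) <= 1 :> A.
Proof. by move=> sqA; rewrite -[1]negK le_neg; apply: sqA. Qed.

Lemma principal_deductive (a : A) :
  square_increasing A -> a <= 1 -> deductive_filter (principal_filter a).
Proof.
move=> sqA a_le1; split; split => //.
- by exists 1.
- by move=> x y ax ay; rewrite /principal_filter /= lexI ax.
- by move=> x y ax; apply: le_trans.
- by move=> x y ax ay; apply: (le_trans (sqA a)); apply: irl_le_mul.
Qed.

End IRLTheory.

Definition principal_dfilter d (A : irlType d) (sqA : square_increasing A)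
    (a : A) (a_le1 : a <= 1) : dfilter A :=
  DFilter (principal_deductive sqA a_le1).

Section Congruence.
Context {d : Order.disp_t} {A : irlType d}.
Variable F : dfilter A.
Local Notation G := (dfilter_set F).
Implicit Types x y z t : A.

Definition dfilter_rel : rel A :=
  fun a b => (imp a b \in G) && (imp b a \in G).

Let G1 : G 1. Proof. by case: (dfilterP F) => _ []. Qed.
Let GM x y : G x -> G y -> G (x * y).
Proof. by case: (dfilterP F) => _ [_]; apply. Qed.
Let GI x y : G x -> G y -> G (x `&` y).
Proof. by case: (dfilterP F) => [[_ h _]] _; apply: h. Qed.
Let Gle x y : G x -> x <= y -> G y.
Proof. by case: (dfilterP F) => [[_ _ h]] _; apply: h. Qed.

Lemma dfilter_relP a b : reflect (G (imp a b) /\ G (imp b a)) (dfilter_rel a b).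
Proof.
apply: (iffP andP) => -[]; first by move=> /set_mem ? /set_mem.
by move=> ? ?; split; apply: mem_set.
Qed.

Lemma dfilter_imp_le x y : x <= y -> G (imp x y).
Proof. by move=> le_xy; apply: (Gle G1); rewrite le_imp mul1g. Qed.

Lemma dfilter_imp_trans x y z : G (imp x y) -> G (imp y z) -> G (imp x z).
Proof.
move=> xy yz; apply: (Gle (GM yz xy)); rewrite le_imp -mulgA.
apply: le_trans (imp_mp y z); apply: irl_le_mul => //; exact: imp_mp.
Qed.

Lemma dfilter_imp_mul x y z : G (imp x y) -> G (imp (x * z) (y * z)).
Proof.
move=> xy; apply: (Gle xy); rewrite le_imp mulgA.
by apply: irl_le_mul => //; apply: imp_mp.
Qed.

Lemma dfilter_imp_meet x y z :
  G (imp x (y `&` z)) <-> G (imp x y) /\ G (imp x z).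
Proof.
split=> [h|[xy xz]].
  by split; apply: (dfilter_imp_trans h); apply: dfilter_imp_le;
     rewrite ?leIl ?leIr.
apply: (Gle (GI xy xz)); rewrite le_imp lexI -!le_imp.
by rewrite leIl leIr.
Qed.

Lemma dfilter_imp_join x y z :
  G (imp (x `|` y) z) <-> G (imp x z) /\ G (imp y z).
Proof.
split=> [h|[xz yz]].
  by split; apply: dfilter_imp_trans h; apply: dfilter_imp_le;
     rewrite ?leUl ?leUr.
apply: (Gle (GI xz yz)); rewrite le_imp irl_mulC -le_imp leUx !le_imp.
rewrite ![_ * (_ `&` _)]irl_mulC -!le_imp leIl leIr //.
Qed.

Lemma dfilter_rel_equiv : equiv_class_of dfilter_rel.
Proof.
split=> [x|x y|y x z].
- by apply/dfilter_relP; split; apply: dfilter_imp_le.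
- by rewrite /dfilter_rel andbC.
- move=> /dfilter_relP[xy yx] /dfilter_relP[yz zy]; apply/dfilter_relP.
  by split; apply: (@dfilter_imp_trans _ y).
Qed.

Canonical dfilter_equiv := EquivRelPack dfilter_rel_equiv.

Local Open Scope quotient_scope.

Definition quot : Type := {eq_quot dfilter_equiv}.

HB.instance Definition _ := Choice.on quot.
HB.instance Definition _ := EqQuotient.on quot.

Lemma quot_eqP x y :
  reflect (G (imp x y) /\ G (imp y x)) (\pi_quot x == \pi_quot y).
Proof. by rewrite eqquotE; apply: dfilter_relP. Qed.

Definition quot_one : quot := \pi_quot 1.
Definition quot_neg (a : quot) : quot := \pi_quot (neg (repr a)).
Definition quot_mul (a b : quot) : quot := \pi_quot (repr a * repr b).
Definition quot_meet (a b : quot) : quot := \pi_quot (repr a `&` repr b).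
Definition quot_join (a b : quot) : quot := \pi_quot (repr a `|` repr b).

Let repr_pi x : G (imp (repr (\pi_quot x)) x) /\ G (imp x (repr (\pi_quot x))).
Proof. by apply/quot_eqP; rewrite reprK. Qed.

Lemma quot_negE x : quot_neg (\pi_quot x) = \pi_quot (neg x).
Proof.
by apply/eqP/quot_eqP; have [? ?] := repr_pi x; rewrite !imp_negC.
Qed.

Lemma quot_mulE x y : quot_mul (\pi_quot x) (\pi_quot y) = \pi_quot (x * y).
Proof.
apply/eqP/quot_eqP; have [rx xr] := repr_pi x; have [ry yr] := repr_pi y.
split.
  apply: (dfilter_imp_trans (dfilter_imp_mul _ rx)).
  by rewrite ![x * _]irl_mulC; apply: dfilter_imp_mul.
apply: dfilter_imp_trans (dfilter_imp_mul _ xr).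
by rewrite ![x * _]irl_mulC; apply: dfilter_imp_mul.
Qed.

Lemma quot_meetE x y : quot_meet (\pi_quot x) (\pi_quot y) = \pi_quot (x `&` y).
Proof.
apply/eqP/quot_eqP; have [rx xr] := repr_pi x; have [ry yr] := repr_pi y.
split; apply/dfilter_imp_meet; split.
- by apply: dfilter_imp_trans rx; apply: dfilter_imp_le; rewrite leIl.
- by apply: dfilter_imp_trans ry; apply: dfilter_imp_le; rewrite leIr.
- by apply: dfilter_imp_trans xr; apply: dfilter_imp_le; rewrite leIl.
- by apply: dfilter_imp_trans yr; apply: dfilter_imp_le; rewrite leIr.
Qed.

Lemma quot_joinE x y : quot_join (\pi_quot x) (\pi_quot y) = \pi_quot (x `|` y).
Proof.
apply/eqP/quot_eqP; have [rx xr] := repr_pi x; have [ry yr] := repr_pi y.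
split; apply/dfilter_imp_join; split.
- by apply: (dfilter_imp_trans rx); apply: dfilter_imp_le; rewrite leUl.
- by apply: (dfilter_imp_trans ry); apply: dfilter_imp_le; rewrite leUr.
- by apply: (dfilter_imp_trans xr); apply: dfilter_imp_le; rewrite leUl.
- by apply: (dfilter_imp_trans yr); apply: dfilter_imp_le; rewrite leUr.
Qed.

Fact quot_mulA : associative quot_mul.
Proof.
elim/quotW=> x; elim/quotW=> y; elim/quotW=> z.
by rewrite (quot_mulE y z) (quot_mulE x y) (quot_mulE x) quot_mulE mulgA.
Qed.

Fact quot_mulC : commutative quot_mul.
Proof. by elim/quotW=> x; elim/quotW=> y; rewrite (quot_mulE x) (quot_mulE y) irl_mulC. Qed.

Fact quot_mul1g : left_id quot_one quot_mul.
Proof. by elim/quotW=> x; rewrite quot_mulE mul1g. Qed.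

Fact quot_mulg1 : right_id quot_one quot_mul.
Proof. by elim/quotW=> x; rewrite quot_mulE mulg1. Qed.

HB.instance Definition _ := isMonoid.Build quot quot_mulA quot_mul1g quot_mulg1.

Fact quot_meetC : commutative quot_meet.
Proof. by elim/quotW=> x; elim/quotW=> y; rewrite (quot_meetE x) (quot_meetE y) meetC. Qed.

Fact quot_joinC : commutative quot_join.
Proof. by elim/quotW=> x; elim/quotW=> y; rewrite (quot_joinE x) (quot_joinE y) joinC. Qed.

Fact quot_meetA : associative quot_meet.
Proof.
elim/quotW=> x; elim/quotW=> y; elim/quotW=> z.
by rewrite (quot_meetE y z) (quot_meetE x y) (quot_meetE x) quot_meetE meetA.
Qed.

Fact quot_joinA : associative quot_join.
Proof.
elim/quotW=> x; elim/quotW=> y; elim/quotW=> z.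
by rewrite (quot_joinE y z) (quot_joinE x y) (quot_joinE x) quot_joinE joinA.
Qed.

Fact quot_joinKI b a : quot_meet a (quot_join a b) = a.
Proof.
by elim/quotW: a => x; elim/quotW: b => y; rewrite (quot_joinE x) quot_meetE joinKI.
Qed.

Fact quot_meetKU b a : quot_join a (quot_meet a b) = a.
Proof.
by elim/quotW: a => x; elim/quotW: b => y; rewrite (quot_meetE x) quot_joinE meetKU.
Qed.

Definition quot_le : rel quot := fun a b => quot_meet a b == a.

Fact quot_le_refl : reflexive quot_le.
Proof. by elim/quotW=> x; rewrite /quot_le quot_meetE meetxx. Qed.

Fact quot_le_anti : antisymmetric quot_le.
Proof. by move=> a b /andP[/eqP ab /eqP ba]; rewrite -ab quot_meetC ba. Qed.

Fact quot_le_trans : transitive quot_le.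
Proof.
move=> b a c /eqP ab /eqP bc; apply/eqP.
by rewrite -ab -quot_meetA bc.
Qed.

HB.instance Definition _ :=
  Order.Le_isPOrder.Build d quot quot_le_refl quot_le_anti quot_le_trans.

HB.instance Definition _ :=
  Order.POrder_isLattice.Build d quot quot_meetC quot_joinC quot_meetA
    quot_joinA quot_joinKI quot_meetKU (fun _ _ => erefl).

Lemma quot_leP x y : reflect (G (imp x y)) (\pi_quot x <= \pi_quot y).
Proof.
rewrite /Order.le /= /quot_le quot_meetE; apply: (iffP (quot_eqP _ _)).
  by move=> [_ /dfilter_imp_meet[]].
move=> xy; split; first by apply: dfilter_imp_le; rewrite leIl.
by apply/dfilter_imp_meet; split=> //; apply: dfilter_imp_le.
Qed.

Fact quot_negK : involutive quot_neg.
Proof. by elim/quotW=> x; rewrite (quot_negE x) quot_negE negK. Qed.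

Fact quot_residuation (a b c : quot) :
  (a * b <= c) = (quot_neg c * b <= quot_neg a).
Proof.
elim/quotW: a => x; elim/quotW: b => y; elim/quotW: c => z.
rewrite (quot_negE z) (quot_negE x) [\pi_quot x * _]quot_mulE
  [_ * \pi_quot y]quot_mulE.
by apply/quot_leP/quot_leP; rewrite (imp_residual x y z).
Qed.

HB.instance Definition _ :=
  isIRL.Build d quot quot_mulC quot_negK quot_residuation.

End Congruence.

Arguments quot {d A} F.

(* Main.v *)
Require Import Defs.
From mathcomp Require Import all_boot all_order.
From mathcomp Require Import boolp classical_sets.

(** Since [a * neg a <= f], square-increase gives
    [a^2 * neg a <= a^2 * (neg a)^2 = (a * neg a)^2 <= f^2], that is
    [neg (f^2) <= a^2 -> a]; so [neg (f^2)] in [G] collapses [a^2] onto [a].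
    Conversely [neg (f^2)] is exactly [f^2 -> f]. *)

Local Open Scope group_scope.
Local Open Scope order_scope.

Import Order.TTheory.

(** By residuation this says [a <= imp (neg a) irl_f], whose right side is [a] because
    [neg irl_f = 1]. *)
Lemma mul_neg_le_f d (A : irlType d) (a : A) : a * neg a <= irl_f.
Proof. by rewrite -le_imp /imp [neg irl_f]negK mulg1 negK. Qed.

Lemma neg_f2_le_imp_sq d (A : irlType d) (a : A) :
  square_increasing A -> neg (irl_f ^+ 2) <= imp (a ^+ 2) a.
Proof.
move=> sqA; rewrite le_neg; apply: (@le_trans _ _ (a ^+ 2 * neg a ^+ 2)).
  by apply: irl_le_mul.
rewrite -expgMn; last exact: irl_mulC.
by rewrite !expg2; apply: irl_le_mul; apply: mul_neg_le_f.
Qed.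

Lemma imp_f2_f d (A : irlType d) : imp (irl_f ^+ 2) irl_f = neg (irl_f ^+ 2) :> A.
Proof. by rewrite /imp negK mulg1. Qed.

Lemma quot_sqE d (A : irlType d) (G : dfilter A) (x : A) :
  (\pi_(quot G) x)%qT ^+ 2 = (\pi_(quot G) (x ^+ 2))%qT.
Proof. by rewrite !expg2; apply: quot_mulE. Qed.

Lemma quot_idempotentP d (A : irlType d) (sqA : square_increasing A)
    (G : dfilter A) :
  idempotent_irl (quot G) <-> neg (irl_f ^+ 2) \in (G : set A).
Proof.
split=> [idG | /set_mem Gf].
  apply/mem_set; rewrite -imp_f2_f.
  (* Idempotence at the class of [irl_f] identifies [f^2] with [f], so [G] contains [f^2 -> f]. *)
  by have /eqP/quot_eqP[] := etrans (esym (quot_sqE _ _ G irl_f)) (idG _).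
elim/quotW=> a; rewrite quot_sqE; apply/eqP/quot_eqP; split.
  have [[_ _ Gle] _] := dfilterP G.
  exact: Gle Gf (neg_f2_le_imp_sq _ _ a sqA).
(* The reverse implication [a -> a^2] lies in every filter, as [a <= a^2]. *)
exact/dfilter_imp_le/sqA.
Qed.

Theorem theorem3p5 (d : Order.disp_t) (A : irlType d)
    (sqA : square_increasing A) :
  (forall G : dfilter A, idempotent_irl (quot G) <->
     neg (irl_f ^+ 2) \in (G : set A)) /\
  idempotent_irl (quot (principal_dfilter sqA (neg_f2_le1 sqA))).
Proof.
split=> [G|]; first exact: quot_idempotentP.
(* A principal filter contains its generator. *)
by apply/quot_idempotentP => //; apply/mem_set/lexx.
Qed.
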